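(* Let $G=(V,E)$ be a 3-edge-connected graph with $m$ edges and $n$ vertices, and let $A$ be an Abelian group. Then there is a group isomorphism \[ \mathcal{L}_A(\mathcal{C}(G))\simeq (2A)^{n-1}\oplus A^{m-n+1}. \]
   Context: Graphs may have loops and parallel edges. A cycle of $G$ is a connected subgraph in which every vertex has degree two, regarded as a subset of $E$; $\mathcal{C}(G)$ is the set of cycles and $\chi_C\in\mathbb{Z}^E$ the characteristic vector. A graph is 3-edge-connected if it is connected and remains connected after deleting any at most two edges. For an Abelian group $A$, the $A$-linear hull of the cycles is the subgroup $\mathcal{L}_A(\mathcal{C}(G)) := \{\sum_{C\in\mathcal{C}(G)} a_C\chi_C : a_C\in A\}\subseteq A^E$, where $a\chi_C\in A^E$ has entry $a$ at the edges of $C$ and $0$ elsewhere. Here $2A=\{2a: a\in A\}$. *)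

(* Defs.v *)
From HB Require Import structures.
From mathcomp Require Import all_boot all_algebra.
From mathcomp Require Import boolp.

Set Implicit Arguments.
Unset Strict Implicit.
Unset Printing Implicit Defensive.

Import GRing.Theory.
Local Open Scope ring_scope.

(* Finite undirected multigraphs.  The order of the two components of [ends e]
   carries no meaning: every notion below is invariant under swapping them.
   [e] is a loop when they coincide. *)
Record mgraph := MGraph {
  vertex : finType;
  edge : finType;
  ends : edge -> vertex * vertex }.

Section Graphs.
Variable G : mgraph.
Implicit Types (W : {set vertex G}) (F C D : {set edge G}).

Definition is_subgraph W F : bool :=
  [forall e in F, ((ends e).1 \in W) && ((ends e).2 \in W)].

Definition adjacent F : rel (vertex G) :=
  fun u v => [exists e in F, (ends e == (u, v)) || (ends e == (v, u))].

(* Connected graphs are nonempty.  When [is_subgraph W F] holds, paths along [F]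
   starting in [W] stay in [W]. *)
Definition connected_subgraph W F : bool :=
  [&& is_subgraph W F, W != set0 &
      [forall u in W, forall v in W, connect (adjacent F) u v]].

(* A loop counts twice. *)
Definition degree F (v : vertex G) : nat :=
  (#|[set e in F | (ends e).1 == v]| + #|[set e in F | (ends e).2 == v]|)%N.

Definition is_cycle C : bool :=
  [exists W : {set vertex G},
     connected_subgraph W C && [forall v in W, degree C v == 2%N]].

Definition cycles : {set {set edge G}} := [set C | is_cycle C].

Definition three_edge_connected : Prop :=
  connected_subgraph setT setT /\
  forall D, (#|D| <= 2)%N -> connected_subgraph setT (~: D).

End Graphs.

Section CycleHull.
Variables (A : zmodType) (G : mgraph).

Definition scaled_chi (a : A) (C : {set edge G}) : {ffun edge G -> A} :=
  [ffun e => if e \in C then a else 0].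

Definition in_cycle_hull : {pred {ffun edge G -> A}} :=
  fun x => `[< exists a : {set edge G} -> A,
                 x = \sum_(C in cycles G) scaled_chi (a C) C >].

Fact in_cycle_hull_zmod_closed : zmod_closed in_cycle_hull.
Proof.
split.
  apply/asboolP; exists (fun=> 0); rewrite big1 // => C _.
  by apply/ffunP => e; rewrite !ffunE if_same.
move=> x y /asboolP[a ->] /asboolP[b ->]; apply/asboolP.
exists (fun C => a C - b C); rewrite -sumrB; apply: eq_bigr => C _.
by apply/ffunP => e; rewrite !ffunE; case: ifP; rewrite ?subr0.
Qed.

HB.instance Definition _ :=
  GRing.isZmodClosed.Build _ in_cycle_hull in_cycle_hull_zmod_closed.

Record cycle_hull := CycleHull {
  cycle_hull_val :> {ffun edge G -> A};
  _ : cycle_hull_val \in in_cycle_hull }.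

HB.instance Definition _ := [isSub for cycle_hull_val].
HB.instance Definition _ := [Choice of cycle_hull by <:].
HB.instance Definition _ := [SubChoice_isSubZmodule of cycle_hull by <:].

End CycleHull.

Section Doubles.
Variable A : zmodType.

Definition in_doubles : {pred A} := fun x => `[< exists a : A, x = a *+ 2 >].

Fact in_doubles_zmod_closed : zmod_closed in_doubles.
Proof.
split; first by apply/asboolP; exists 0; rewrite mul0rn.
move=> x y /asboolP[a ->] /asboolP[b ->]; apply/asboolP.
by exists (a - b); rewrite mulrnBl.
Qed.

HB.instance Definition _ :=
  GRing.isZmodClosed.Build _ in_doubles in_doubles_zmod_closed.

Record doubles := Doubles {
  doubles_val :> A;
  _ : doubles_val \in in_doubles }.

HB.instance Definition _ := [isSub for doubles_val].
HB.instance Definition _ := [Choice of doubles by <:].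
HB.instance Definition _ := [SubChoice_isSubZmodule of doubles by <:].

End Doubles.

Definition zmod_isomorphic (U V : zmodType) : Prop :=
  exists f : {additive U -> V}, bijective f.

(* Main.v *)
Require Import Defs.
From HB Require Import structures.
From mathcomp Require Import all_boot all_algebra.
From mathcomp Require Import boolp zify.

Set Implicit Arguments.
Unset Strict Implicit.
Unset Printing Implicit Defensive.

Import GRing.Theory Num.Theory.
Local Open Scope ring_scope.

(** Call an edge set even if all its degrees are even; even sets are disjoint unions
    of cycles, so the hull contains [a * chi_F] for every even [F].  It also contains
    [2 a * chi_e] for every edge [e]: by 3-edge-connectivity the ends of [e] are joined
    by two edge-disjoint paths [P], [Q] avoiding [e], and
    [2 chi_e = chi_(e + P) + chi_(e + Q) - chi_(P + Q)].
    Fix a spanning tree [T] and its fundamental circuits [D_e], [e] outside [T].  Modulo 2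
    a cycle [C] is the sum of the [D_e] with [e] in [C \ T], so [chi_C] minus the integral
    sum of these [chi_(D_e)] has even entries and is supported on [T].  Hence the hull is
    the direct sum of the [A * chi_(D_e)] and the [2A * chi_t], [t] in [T]. *)

Lemma odd_abszD (a b : int) : odd (absz (a + b)) = odd (absz a) (+) odd (absz b).
Proof. lia. Qed.

(** * Degree parities, integral flows, and paths as flows *)

Section GraphFacts.
Variable G : mgraph.
Implicit Types (W : {set vertex G}) (F C D P Q T : {set edge G}).
Implicit Types (e f g : edge G) (u v w : vertex G).

Definition src f := (ends f).1.
Definition tgt f := (ends f).2.

Definition incidence f v : nat := ((src f == v) + (tgt f == v))%N.

Lemma degreeE F v : degree F v = (\sum_(f in F) incidence f v)%N.
Proof.
rewrite /degree big_split /=; congr (_ + _)%N; rewrite -sum1_card;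
  rewrite big_mkcond [RHS]big_mkcond /=; apply: eq_bigr => f _;
  by rewrite inE /src /tgt; case: (f \in F) => //=; case: ifP => _.
Qed.

Lemma degreeU F D v : [disjoint F & D] ->
  degree (F :|: D) v = (degree F v + degree D v)%N.
Proof.
move=> dFD; rewrite !degreeE -bigU //=.
by apply: eq_bigl => f; rewrite !inE.
Qed.

Lemma degree1 f v : degree [set f] v = incidence f v.
Proof. by rewrite degreeE big_set1. Qed.

Lemma odd_degree (c : edge G -> nat) v :
  odd (degree [set f | odd (c f)] v) = odd (\sum_f c f * incidence f v)%N.
Proof.
rewrite degreeE big_mkcond /= !(big_morph odd oddD (erefl _)).
by apply: eq_bigr => f _; rewrite inE oddM; case: (odd (c f)).
Qed.

Definition even_set F : bool := [forall v, ~~ odd (degree F v)].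

(** The net outflow at [v] for the arbitrary orientation that the pairs [ends] provide; loops
    contribute nothing. *)
Definition divergence (y : edge G -> int) v : int :=
  \sum_f y f * ((src f == v)%:R - (tgt f == v)%:R).

(** Signs disappear modulo 2, so an integral flow yields an edge set whose degree parities are
    known. *)
Lemma odd_divergence (y : edge G -> int) v :
  odd (degree [set f | odd (absz (y f))] v) = odd (absz (divergence y v)).
Proof.
rewrite odd_degree (big_morph odd oddD (erefl _)).
rewrite /divergence (big_morph (fun z : int => odd (absz z)) odd_abszD (erefl _)).
apply: eq_bigr => f _; rewrite /incidence oddM abszM oddM; congr (_ && _).
by case: (_ == _); case: (_ == _).
Qed.

Lemma divergenceD (y z : edge G -> int) v :
  divergence (fun f => y f + z f) v = divergence y v + divergence z v.
Proof. by rewrite -big_split; apply: eq_bigr => f _; rewrite mulrDl. Qed.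

Lemma divergenceN (y : edge G -> int) v :
  divergence (fun f => - y f) v = - divergence y v.
Proof. by rewrite -sumrN; apply: eq_bigr => f _; rewrite mulNr. Qed.

Lemma divergence_delta (c : int) g v :
  divergence (fun f => if f == g then c else 0) v =
  c * ((src g == v)%:R - (tgt g == v)%:R).
Proof.
rewrite /divergence (bigD1 g) //= eqxx big1 ?addr0 // => f /negPf->.
by rewrite mul0r.
Qed.

Lemma sum_eq_mem u W : (\sum_(w in W) (u == w) = (u \in W))%N.
Proof.
case: (boolP (u \in W)) => uW.
  rewrite (bigD1 u) //= eqxx big1 ?addn0 // => w /andP[_].
  by rewrite eq_sym => /negPf ->.
rewrite big1 // => w wW; case: eqP => // uw.
by rewrite uw wW in uW.
Qed.

Lemma sum_divergence (y : edge G -> int) W :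
  \sum_(w in W) divergence y w =
  \sum_f y f * ((src f \in W)%:R - (tgt f \in W)%:R).
Proof.
rewrite exchange_big /=; apply: eq_bigr => f _.
by rewrite -mulr_sumr sumrB -!natr_sum !sum_eq_mem.
Qed.

Lemma sum_degree F W :
  (\sum_(w in W) degree F w =
   \sum_(f in F) ((src f \in W) + (tgt f \in W)))%N.
Proof.
under eq_bigr do rewrite degreeE.
by rewrite exchange_big; apply: eq_bigr => f _; rewrite big_split /= !sum_eq_mem.
Qed.

Definition carrier (y : edge G -> int) : {set edge G} := [set f | y f != 0].

Lemma adjacentC F : symmetric (adjacent F).
Proof. by move=> u v; apply/exists_inP/exists_inP => -[f fF ?]; exists f; rewrite // orbC. Qed.

Lemma adjacent_connectS F D u v : F \subset D ->
  connect (adjacent F) u v -> connect (adjacent D) u v.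
Proof.
move=> sFD; apply: connect_sub => s t /exists_inP[f fF h].
by apply/connect1/exists_inP; exists f => //; apply: (subsetP sFD).
Qed.

Lemma uncut_connect F W u v :
  (forall f, f \in F -> (src f \in W) = (tgt f \in W)) ->
  connect (adjacent F) u v -> (u \in W) = (v \in W).
Proof.
move=> uncut; apply: closed_connect => s t /exists_inP[f fF].
by move: (uncut f fF); rewrite /src /tgt => + /orP[]/eqP e; rewrite e.
Qed.

(* [a f true] allows traversing [f] from [src f] to [tgt f], [a f false] backwards. *)
Definition dart_rel (a : edge G -> bool -> bool) : rel (vertex G) := fun s t =>
  [exists f, (a f true && (ends f == (s, t))) || (a f false && (ends f == (t, s)))].

Definition signed_by (a : edge G -> bool -> bool) (y : edge G -> int) : Prop :=
  forall f, [\/ y f = 0, y f = 1 /\ a f true | y f = -1 /\ a f false].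

(** Induction on the path, prepending one edge at a time. The additive form of the degree clause
    also covers the trivial path, and says that an extra edge joining the two ends makes all degrees
    on the path two. *)
Lemma path_flow a u p : path (dart_rel a) u p -> uniq (u :: p) ->
  exists y, [/\ signed_by a y,
    forall w, divergence y w = (u == w)%:R - (last u p == w)%:R,
    forall f, f \in carrier y -> (src f \in u :: p) && (tgt f \in u :: p),
    forall w, (degree (carrier y) w + (u == w) + (last u p == w) =
               (w \in u :: p).*2)%N
  & forall w, w \in u :: p -> connect (adjacent (carrier y)) u w].
Proof.
elim: p u => [|t p IHp] u.
  move=> _ _; exists (fun=> 0); split=> //.
  - by move=> f; constructor 1.
  - by move=> w; rewrite subrr /divergence big1 // => f _; rewrite mul0r.
  - by move=> f; rewrite inE eqxx.
  - move=> w; rewrite degreeE big1 ?inE; last by move=> f; rewrite inE eqxx.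
    by rewrite eq_sym /=; case: eqP.
  - by move=> w; rewrite inE => /eqP->.
rewrite [path _ _ _]/= => /andP[/existsP[g gut] tp].
rewrite cons_uniq => /andP[unotin tpuniq].
have [y [ysign ydiv yends ydeg yconn]] := IHp t tp tpuniq.
have gends : ends g = (u, t) \/ ends g = (t, u).
  by case/orP: gut => /andP[_ /eqP ->]; [left|right].
(* [g] has the end [u], which the rest of the simple path never visits. *)
have yg0 : y g = 0.
  apply/eqP/negPn/negP => yg; have := yends g; rewrite inE => /(_ yg).
  by rewrite /src /tgt; case: gends => -> /=; rewrite (negPf unotin) // andbF.
(* [s] is the sign with which [g] is traversed from [u] to [t]. *)
have [s [s0 sa sdiv]] : exists s : int, [/\ s != 0,
    s = 1 /\ a g true \/ s = -1 /\ a g false &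
    forall w, s * ((src g == w)%:R - (tgt g == w)%:R) =
              (u == w)%:R - (t == w)%:R].
  case/orP: gut => /andP[ag /eqP eg]; [exists 1|exists (-1)]; split=> //.
  - by left.
  - by move=> w; rewrite /src /tgt eg mul1r.
  - by right.
  - by move=> w; rewrite /src /tgt eg mulN1r opprB.
pose y' f := if f == g then s else y f.
have y'supp : carrier y' = g |: carrier y.
  by apply/setP => f; rewrite !inE /y'; case: (f == g) => //; rewrite s0.
have gsupp : g \notin carrier y by rewrite inE yg0 eqxx.
exists y'; split.
- move=> f; rewrite /y'; case: eqP => [->|_]; last exact: ysign.
  by case: sa => ?; [constructor 2|constructor 3].
- move=> w; rewrite /divergence (bigD1 g) //= /y' eqxx sdiv.
  have -> : \sum_(i | i != g) (if i == g then s else y i) *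
      ((src i == w)%:R - (tgt i == w)%:R) = divergence y w.
    rewrite /divergence [RHS](bigD1 g) //= yg0 mul0r add0r.
    by apply: eq_bigr => i /negPf->.
  by rewrite ydiv addrA subrK.
- move=> f; rewrite y'supp in_setU1 => /orP[/eqP ->|/yends /andP[]].
    by rewrite /src /tgt; case: gends => -> /=; rewrite !inE !eqxx /= ?orbT.
  by rewrite !(in_cons u) => -> ->; rewrite !orbT.
- move=> w; rewrite y'supp degreeU; last by rewrite disjoints1.
  rewrite degree1 /= in_cons eq_sym.
  have -> : incidence g w = ((w == u) + (t == w))%N.
    by rewrite /incidence /src /tgt; case: gends => -> /=; rewrite ?(eq_sym u) // addnC.
  have := ydeg w; clear -unotin.
  case: (eqVneq w u) => [->|_]; last by rewrite /=; lia.
  by rewrite (negPf unotin) /=; lia.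
- have sub : carrier y \subset carrier y' by rewrite y'supp subsetUr.
  move=> w; rewrite in_cons => /orP[/eqP->|/yconn /(adjacent_connectS sub)].
    exact: connect0.
  apply: connect_trans; apply/connect1/exists_inP; exists g.
    by rewrite y'supp setU11.
  by case: gends => ->; rewrite eqxx ?orbT.
Qed.

Lemma connect_flow a u v : connect (dart_rel a) u v ->
  exists2 y, signed_by a y &
    forall w, divergence y w = (u == w)%:R - (v == w)%:R.
Proof.
move=> /connectP[p /shortenP[q uq quniq _] ->].
by have [y [? ? _ _ _]] := path_flow uq quniq; exists y.
Qed.

(** An allowed step out of [W] would reach a new vertex. This bounds the flow across [W] in the cut
    arguments. *)
Lemma reach_closed a u f : let W := [set w | connect (dart_rel a) u w] in
  (src f \in W -> tgt f \notin W -> ~~ a f true) /\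
  (src f \notin W -> tgt f \in W -> ~~ a f false).
Proof.
rewrite /= !inE; split=> [h1 h2|h1 h2]; apply/negP => af.
  case/negP: h2; apply: (connect_trans h1); apply/connect1/existsP; exists f.
  by rewrite af /src /tgt -surjective_pairing eqxx.
case/negP: h1; apply: (connect_trans h2); apply/connect1/existsP; exists f.
by rewrite af /src /tgt -surjective_pairing eqxx orbT.
Qed.

End GraphFacts.

(** * Even edge sets and their decomposition into cycles *)

Section Even.
Variable G : mgraph.
Implicit Types (W : {set vertex G}) (F C D P Q T : {set edge G}).
Implicit Types (e f g : edge G) (u v w : vertex G).

Lemma even_setP F : reflect (forall v, ~~ odd (degree F v)) (even_set F).
Proof. exact: forallP. Qed.

Lemma cycle_even C : C \in cycles G -> even_set C.
Proof.
rewrite inE => /existsP[W /andP[/and3P[/forall_inP sub _ _] /forall_inP deg2]].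
apply/even_setP => v; case: (boolP (v \in W)) => [/deg2/eqP->//|vW].
rewrite degreeE big1 // => f /sub /andP[tW hW]; rewrite /incidence.
case: eqP => [tv|_]; first by rewrite -tv tW in vW.
by case: eqP => // hv; rewrite -hv hW in vW.
Qed.

Lemma disjoint_setD F C : [disjoint C & F :\: C].
Proof. by apply/pred0P => f; rewrite /= in_setD; case: (f \in C). Qed.

Lemma even_setD F C : C \subset F -> even_set F -> even_set C -> even_set (F :\: C).
Proof.
move=> sCF /even_setP evF /even_setP evC; apply/even_setP => v.
have := evF v; rewrite -{1}(setID F C) (setIidPr sCF) degreeU ?disjoint_setD //.
by rewrite oddD (negPf (evC v)).
Qed.

(** Handshake parity: if [g] were a bridge of [F], it would add one to the degree sum over the side
    of [src g], while every other edge adds zero or two; but that sum is even. *)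
Lemma even_connect F g : even_set F -> g \in F ->
  connect (adjacent (F :\ g)) (src g) (tgt g).
Proof.
move=> /even_setP evF gF; apply/negPn/negP => nconn.
pose W := [set w | connect (adjacent (F :\ g)) (src g) w].
have uncut f : f \in F :\ g -> (src f \in W) = (tgt f \in W).
  move=> fF; rewrite !inE; apply: same_connect_r.
    by apply: sym_connect_sym; exact: adjacentC.
  by apply/connect1/exists_inP; exists f; rewrite // /src /tgt -surjective_pairing eqxx.
have : ~~ odd (\sum_(w in W) degree F w)%N.
  rewrite (big_morph odd oddD (erefl _)) big1 // => w _.
  by rewrite (negPf (evF w)).
rewrite sum_degree (bigD1 g) //= oddD inE connect0 inE (negPf nconn) /=.
rewrite (big_morph odd oddD (erefl _)) big1 // => f /andP[fF fg].
by rewrite uncut ?in_setD1 ?fg // oddD addbb.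
Qed.

Definition within F : edge G -> bool -> bool := fun f _ => f \in F.

Lemma dart_rel_within F : dart_rel (within F) =2 adjacent F.
Proof.
move=> s t; apply/existsP/exists_inP => -[f].
  by rewrite -andb_orr => /andP[? ?]; exists f.
by move=> fF h; exists f; rewrite -andb_orr; apply/andP.
Qed.

(** A simple path in [F :\ g] between the ends of [g] is closed up by [g]. For a loop the path is
    trivial. *)
Lemma cycle_through F g : even_set F -> g \in F ->
  exists C, [/\ C \in cycles G, g \in C & C \subset F].
Proof.
move=> evF gF; have := even_connect evF gF.
rewrite -(eq_connect (dart_rel_within _)) => /connectP[p0 /shortenP[p pp puniq _] hp].
have [y [ysign _ yends ydeg yconn]] := path_flow pp puniq.
have sub : carrier y \subset F :\ g.
  apply/subsetP => f; rewrite inE.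
  by case: (ysign f) => [->|[_ //]|[_ //]]; rewrite eqxx.
have gy : g \notin carrier y.
  by apply/negP => /(subsetP sub); rewrite !inE eqxx.
exists (g |: carrier y); split; last 1 first.
- rewrite subUset sub1set gF /=; apply: (subset_trans sub); exact: subsetDl.
- rewrite inE; apply/existsP; exists [set w in src g :: p].
  have tp : src g \in src g :: p by rewrite mem_head.
  have hgp : tgt g \in src g :: p by rewrite hp mem_last.
  apply/andP; split; last first.
    apply/forall_inP => w; rewrite inE => wp.
    have := ydeg w; rewrite wp -hp degreeU ?disjoints1 // degree1 /incidence.
    by clear -G => h; apply/eqP; lia.
  apply/and3P; split.
  + apply/forall_inP => f; rewrite in_setU1 !(in_set (fun x => x \in _)).
    by case/orP => [/eqP->|/yends //]; apply/andP.
  + by apply/set0Pn; exists (src g); rewrite inE.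
  + have conn w : w \in src g :: p ->
        connect (adjacent (g |: carrier y)) (src g) w.
      by move/yconn; apply: adjacent_connectS; exact: subsetUr.
    apply/forall_inP => u; rewrite inE => /conn cu.
    apply/forall_inP => v; rewrite inE => /conn cv.
    apply: connect_trans cv.
    by rewrite (sym_connect_sym (@adjacentC _ _)).
- exact: setU11.
Qed.

Section Hull.
Variable A : zmodType.
Notation hull := (@in_cycle_hull A G).

Lemma scaled_chi0 (a : A) : scaled_chi a set0 = 0 :> {ffun edge G -> A}.
Proof. by apply/ffunP => f; rewrite !ffunE inE. Qed.

Lemma scaled_chiU (a : A) F D : [disjoint F & D] ->
  scaled_chi a (F :|: D) = scaled_chi a F + scaled_chi a D.
Proof.
move=> dFD; apply/ffunP => f; rewrite !ffunE inE.
case: (boolP (f \in F)) => [fF|_]; last by rewrite add0r.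
by rewrite (disjointFr dFD fF) addr0.
Qed.

Lemma hull_cycle (a : A) C : C \in cycles G -> scaled_chi a C \in hull.
Proof.
move=> Ccyc; apply/asboolP; exists (fun D => if D == C then a else 0).
rewrite (bigD1 C) //= eqxx big1 ?addr0 // => D /andP[_ /negPf->].
by apply/ffunP => f; rewrite !ffunE if_same.
Qed.

(** Induction on the size of [F]: a cycle through any of its edges splits off and leaves a smaller
    even set. *)
Lemma hull_even (a : A) F : even_set F -> scaled_chi a F \in hull.
Proof.
have [k] := ubnP #|F|; elim: k F => // k IHk F ltFk evF.
case: (set_0Vmem F) => [->|[g gF]]; first by rewrite scaled_chi0 rpred0.
have [C [Ccyc gC sCF]] := cycle_through evF gF.
rewrite -(setID F C) (setIidPr sCF) scaled_chiU ?disjoint_setD //.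
apply: rpredD; first exact: hull_cycle.
apply: IHk; last by apply: even_setD => //; exact: cycle_even.
rewrite -ltnS; apply: leq_trans ltFk; rewrite ltnS; apply: proper_card.
by apply/properP; split; [exact: subsetDl|exists g; rewrite // inE gC].
Qed.

End Hull.

End Even.

(** * Cuts and flows of value two *)

Section Connectivity.
Variable G : mgraph.
Implicit Types (W : {set vertex G}) (F C D P Q T : {set edge G}).
Implicit Types (e f g : edge G) (u v w r : vertex G).

Definition cut W : {set edge G} := [set f | (src f \in W) != (tgt f \in W)].

Lemma cut_gt2 W u v : three_edge_connected G -> u \in W -> v \notin W ->
  (2 < #|cut W|)%N.
Proof.
move=> [_ conn] uW vW; rewrite ltnNge; apply/negP => /conn /and3P[_ _].
move=> /forall_inP/(_ u (in_setT _))/forall_inP/(_ v (in_setT _)).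
move=> c; suff: (u \in W) = (v \in W) by rewrite uW (negPf vW).
by apply: uncut_connect c => f; rewrite !inE negbK => /eqP.
Qed.

(** A unit-capacity flow of value [k] between the ends of [e], avoiding [e]. It replaces [k]
    edge-disjoint paths without tracking them individually. *)
Definition unit_flow e (k : nat) (x : edge G -> int) : Prop :=
  [/\ x e = 0, forall f, [\/ x f = 0, x f = 1 | x f = -1] &
    forall w, divergence x w = k%:R * ((src e == w)%:R - (tgt e == w)%:R)].

(** Inside [W] only [src e] has a nonzero divergence, so the full value crosses the cut. *)
Lemma sum_unit_flow e k x W : unit_flow e k x -> src e \in W -> tgt e \notin W ->
  \sum_f x f * ((src f \in W)%:R - (tgt f \in W)%:R) = k%:R.
Proof.
move=> [_ _ xdiv] sW tW; rewrite -sum_divergence.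
rewrite (bigD1 (src e)) //= xdiv eqxx big1 => [|w /andP[wW ws]].
  by case: eqP tW => [->|_]; [rewrite sW|rewrite addr0 subr0 mulr1].
rewrite xdiv eq_sym (negPf ws); case: eqP tW => [->|_ _]; first by rewrite wW.
by rewrite subrr mulr0.
Qed.

(* Ford-Fulkerson: the vertices reachable in the residual graph would otherwise
   span a cut with only [k + 1] edges, one of them [e]. *)
Lemma augment e k x : three_edge_connected G -> (k < 2)%N ->
  src e != tgt e -> unit_flow e k x -> exists x', unit_flow e k.+1 x'.
Proof.
move=> hG k2 st xflow; have [xe xunit xdiv] := xflow.
(* The residual graph without [e]: a step is allowed when it keeps the value on [f] within [-1],
   [0], [1]. *)
pose a f (b : bool) := (f != e) && (if b then x f <= 0 else 0 <= x f).
case: (boolP (connect (dart_rel a) (src e) (tgt e))) => [conn|nconn].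
  have [y ysign ydiv] := connect_flow conn.
  exists (fun f => x f + y f); split.
  - by case: (ysign e) => [->|[_]|[_]]; rewrite ?xe // /a eqxx.
  - move=> f; case: (ysign f) => [->|[->]|[->]]; rewrite ?addr0 //.
      by case/andP=> _; case: (xunit f) => -> // _; [constructor 2|constructor 1].
    by case/andP=> _; case: (xunit f) => -> // _; [constructor 3|constructor 1].
  - by move=> w; rewrite divergenceD xdiv ydiv -natr1 mulrDl mul1r.
pose W := [set w | connect (dart_rel a) (src e) w].
have sW : src e \in W by rewrite inE connect0.
have tW : tgt e \notin W by rewrite inE.
have := sum_unit_flow xflow sW tW.
(* Since [W] is closed under residual steps, every cut edge other than [e] is saturated outwards and
   counts one. *)
have -> : \sum_f x f * ((src f \in W)%:R - (tgt f \in W)%:R) = #|cut W :\ e|%:R.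
  rewrite -sum1_card natr_sum [RHS]big_mkcond /=; apply: eq_bigr => f _.
  rewrite in_setD1 [f \in cut W]inE.
  case: (eqVneq f e) => [->|fe]; first by rewrite xe mul0r.
  have [out into] := reach_closed a (src e) f.
  move: out into; rewrite -/W /a fe /=.
  case: (src f \in W); case: (tgt f \in W) => /=; rewrite ?subrr ?mulr0 //.
    by move=> /(_ isT isT) + _; case: (xunit f) => ->.
  by move=> _ /(_ isT isT); case: (xunit f) => ->.
move=> /eqP; rewrite eqr_nat => /eqP ck.
have := cut_gt2 hG sW tW; rewrite (cardsD1 e) ck.
by case: (e \in cut W); lia.
Qed.

Lemma two_flow e : three_edge_connected G -> src e != tgt e ->
  exists x, unit_flow e 2 x.
Proof.
move=> hG st; have flow0 : unit_flow e 0 (fun=> 0).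
  split=> // [f|w]; first by constructor 1.
  by rewrite mul0r /divergence big1 // => f _; rewrite mul0r.
have [x1 flow1] := augment hG (isT : 0 < 2)%N st flow0.
exact: augment hG (isT : 1 < 2)%N st flow1.
Qed.

(** Splits one path off by following edges in their flow direction. If [tgt e] were unreachable, no
    flow would leave the reachable set, yet two units must. *)
Lemma subflow e x : src e != tgt e -> unit_flow e 2 x ->
  exists y, unit_flow e 1 y /\ carrier y \subset carrier x.
Proof.
move=> st xflow; have [xe xunit xdiv] := xflow.
pose a f (b : bool) := x f == (if b then 1 else -1).
case: (boolP (connect (dart_rel a) (src e) (tgt e))) => [conn|nconn].
  have [y ysign ydiv] := connect_flow conn.
  exists y; split; last first.
    apply/subsetP => f; rewrite !inE.
    by case: (ysign f) => [->|[_ /eqP->]|[_ /eqP->]]; rewrite ?eqxx.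
  split; first by case: (ysign e) => // -[_]; rewrite /a xe.
    move=> f; case: (ysign f) => [->|[-> _]|[-> _]];
    by [constructor 1|constructor 2|constructor 3].
  by move=> w; rewrite mul1r.
pose W := [set w | connect (dart_rel a) (src e) w].
have sW : src e \in W by rewrite inE connect0.
have tW : tgt e \notin W by rewrite inE.
have := sum_unit_flow xflow sW tW.
suff : \sum_f x f * ((src f \in W)%:R - (tgt f \in W)%:R) <= 0 by move=> + e2; rewrite e2.
apply: sumr_le0 => f _.
have [out into] := reach_closed a (src e) f.
move: out into; rewrite -/W /a /=.
case: (src f \in W); case: (tgt f \in W) => /=; rewrite ?subrr ?mulr0 //.
  by move=> /(_ isT isT) + _; case: (xunit f) => ->.
by move=> _ /(_ isT isT); case: (xunit f) => ->.
Qed.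

(** As the values are [0], [1] and [-1], the carrier is exactly where the flow is odd. *)
Lemma odd_degree_flow e k x w : unit_flow e k x ->
  odd (degree (carrier x) w) = odd (k * incidence e w).
Proof.
move=> [_ xunit xdiv].
have -> : carrier x = [set f | odd (absz (x f))].
  by apply/setP => f; rewrite !inE; case: (xunit f) => ->.
rewrite odd_divergence xdiv abszM !oddM /incidence natz absz_nat; congr (_ && _).
by case: (_ == _); case: (_ == _).
Qed.

Section Hull.
Variable A : zmodType.
Notation hull := (@in_cycle_hull A G).

(* If [P] and [Q] are disjoint edge sets joining the ends of [e] and avoiding [e],
   then [e + P], [e + Q] and [P + Q] are even, and the first two minus the third is [2e]. *)
Lemma hull_double (a : A) e : three_edge_connected G ->
  scaled_chi (a *+ 2) [set e] \in hull.
Proof.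
move=> hG.
have -> : scaled_chi (a *+ 2) [set e] =
    scaled_chi a [set e] + scaled_chi a [set e] :> {ffun edge G -> A}.
  by apply/ffunP => f; rewrite !ffunE; case: ifP; rewrite ?addr0.
case: (eqVneq (src e) (tgt e)) => [loop|st].
  have ev : even_set [set e].
    by apply/even_setP => v; rewrite degree1 /incidence loop addnn odd_double.
  by apply: rpredD; apply: hull_even.
have [x xflow] := two_flow hG st.
have [y [yflow sub]] := subflow st xflow.
(* [Y] and [X :\: Y] serve as [P] and [Q]; the argument uses only their degree parities. *)
set X := carrier x; set Y := carrier y.
have eX : e \notin X by case: xflow => x0 _ _; rewrite inE x0 eqxx.
have eY : e \notin Y by apply: contra eX; apply: (subsetP sub).
have eXY : e \notin X :\: Y by rewrite inE negb_and eX orbT.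
have XE : X = Y :|: X :\: Y by rewrite -{1}(setID X Y) (setIidPr sub).
have dX v : odd (degree X v) = false by rewrite (odd_degree_flow _ xflow) oddM.
have dY v : odd (degree Y v) = odd (incidence e v).
  by rewrite (odd_degree_flow _ yflow) mul1n.
have dXY v : odd (degree (X :\: Y) v) = odd (incidence e v).
  have := dX v; rewrite {1}XE degreeU ?disjoint_setD // oddD dY.
  by case: odd; case: odd.
have -> : scaled_chi a [set e] + scaled_chi a [set e] =
    scaled_chi a (e |: Y) + scaled_chi a (e |: X :\: Y) - scaled_chi a X
    :> {ffun edge G -> A}.
  rewrite {2}XE !scaled_chiU ?disjoints1 ?disjoint_setD //.
  by rewrite addrACA addrK.
apply: rpredB; first apply: rpredD; apply: hull_even; apply/even_setP => v.
- by rewrite degreeU ?disjoints1 // degree1 oddD dY addbb.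
- by rewrite degreeU ?disjoints1 // degree1 oddD dXY addbb.
- by rewrite dX.
Qed.

End Hull.

(** * Spanning trees and fundamental circuits *)

Lemma isolated_edge_even T D g u : g \notin T -> D \subset g |: T -> even_set D ->
  odd (incidence g u) -> (forall f, f \in T -> incidence f u = 0%N) -> D \subset T.
Proof.
move=> gT sD /even_setP evD gu Tu.
have gD : g \notin D.
  apply: contraTN gu => gD; have := evD u; rewrite degreeE (bigD1 g) //= big1 ?addn0 //.
  move=> f /andP[fD fg]; apply: Tu; have := subsetP sD f fD.
  by rewrite in_setU1 (negPf fg).
apply/subsetP => f fD; have := subsetP sD f fD; rewrite in_setU1.
by case: (eqVneq f g) => // fg; rewrite -fg fD in gD.
Qed.

(** Phrased with even sets instead of cycles, which is equivalent by [cycle_through] and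
    [cycle_even] and suits arguments modulo 2. *)
Definition acyclic T := forall D, D \subset T -> even_set D -> D = set0.

(** A walk in [T] recorded as an integral flow, so that concatenation is addition and reversal is
    negation. *)
Definition joined T r w := exists y : edge G -> int,
  (forall f, f \notin T -> y f = 0) /\
  forall v, divergence y v = (r == v)%:R - (w == v)%:R.

(** The tree grows along an edge leaving [W]. The new vertex meets no older tree edge, so
    [isolated_edge_even] preserves acyclicity. *)
Lemma partial_tree r k : connected_subgraph [set: vertex G] setT ->
  (k < #|vertex G|)%N ->
  exists W T, [/\ r \in W, #|W| = k.+1, #|T| = k, is_subgraph W T &
    acyclic T /\ forall w, w \in W -> joined T r w].
Proof.
move=> /and3P[_ _ /forall_inP/(_ r (in_setT _))/forall_inP conn].
elim: k => [|k IHk] ltk.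
  exists [set r], set0; split; rewrite ?set11 ?cards1 ?cards0 //.
    by apply/forall_inP => f; rewrite in_set0.
  split=> [D|w]; first by rewrite subset0 => /eqP.
  move/set1P->; exists (fun=> 0); split=> // v; rewrite subrr.
  by rewrite /divergence big1 // => f _; rewrite mul0r.
have [W [T [rW cW cT /forall_inP sWT [acT joinT]]]] := IHk (ltnW ltk).
have [z zW] : exists z, z \notin W.
  apply/existsP; rewrite -negb_forall; apply/negP => /forallP allW.
  have := ltk; rewrite -cW ltnNge => /negP; apply.
  by apply: subset_leq_card; apply/subsetP => u _; apply: allW.
have [g cutg] : exists g, (src g \in W) != (tgt g \in W).
  apply/existsP; rewrite -[[exists _, _]]negbK negb_exists; apply/negP => /forallP uncut.
  suff: (r \in W) = (z \in W) by rewrite rW (negPf zW).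
  by apply: uncut_connect (conn z (in_setT _)) => f _; apply/eqP; have := uncut f; rewrite negbK.
have gT : g \notin T.
  by apply: contra cutg => /sWT /andP[]; rewrite /src /tgt => -> ->.
(* [s] is the old end of [g], [t] the new one, and the sign [c] orients [g] from [s] to [t]. *)
have [s [t [c [sW tW gc gst]]]] : exists s t (c : int), [/\ s \in W, t \notin W,
    forall v, c * ((src g == v)%:R - (tgt g == v)%:R) = (s == v)%:R - (t == v)%:R &
    forall v, incidence g v = ((s == v) + (t == v))%N].
  case: (boolP (src g \in W)) cutg => [sW tW|sW tW].
    by exists (src g), (tgt g), 1; split=> // v; rewrite mul1r.
  exists (tgt g), (src g), (-1); split=> //; first by case: (tgt g \in W) tW.
    by move=> v; rewrite mulN1r opprB.
  by move=> v; rewrite addnC.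
exists (t |: W), (g |: T); split.
- by rewrite in_setU1 rW orbT.
- by rewrite cardsU1 tW cW.
- by rewrite cardsU1 gT cT.
- apply/forall_inP => f; rewrite in_setU1 => /orP[/eqP->|/sWT/andP[sf tf]].
    have gW v : (v == src g) || (v == tgt g) -> v \in t |: W.
      rewrite in_setU1; have := gst v; rewrite /incidence !(eq_sym _ v).
      case: (eqVneq v t) => //= _.
      by case: (eqVneq v s) => [->|_]; rewrite ?sW //; case: (_ == _); case: (_ == _).
    by rewrite !gW ?eqxx ?orbT.
  by rewrite !in_setU1 sf tf !orbT.
split.
  move=> D sD evD; apply: acT => //; apply: (isolated_edge_even gT sD evD (u := t)).
    by rewrite gst eqxx addn1 /=; case: eqP tW => // <-; rewrite sW.
  move=> f /sWT/andP[sf tf]; rewrite /incidence.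
  have nt v : v \in W -> (v == t) = false by move=> vW; case: eqP tW => // <-; rewrite vW.
  by rewrite !nt.
have sub f : f \notin g |: T -> f \notin T by apply: contra => fT; rewrite in_setU1 fT orbT.
move=> w; rewrite in_setU1 => /orP[/eqP->|/joinT[y [yT ydiv]]]; last first.
  by exists y; split=> // f /sub; exact: yT.
have [y [yT ydiv]] := joinT s sW.
exists (fun f => y f + if f == g then c else 0); split.
  move=> f fgT; rewrite yT ?sub // add0r.
  by move: fgT; rewrite in_setU1; case: eqP.
by move=> v; rewrite divergenceD ydiv divergence_delta gc addrA subrK.
Qed.

Lemma spanning_tree : connected_subgraph [set: vertex G] setT ->
  exists T, [/\ #|T|.+1 = #|vertex G|, acyclic T &
    forall e, e \notin T -> exists D, even_set D /\
      forall f, f \notin T -> (f \in D) = (f == e)].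
Proof.
move=> conn; have [r _] : exists r, r \in [set: vertex G].
  by apply/set0Pn; case/and3P: conn.
have cV : (#|vertex G|.-1 < #|vertex G|)%N by rewrite ltn_predL; apply/card_gt0P; exists r.
have [W [T [_ cW cT _ [acT joinT]]]] := partial_tree r conn cV.
have WT w : w \in W.
  suff -> : W = setT by [].
  by apply/eqP; rewrite eqEcard subsetT cardsT cW (ltn_predK cV) leqnn.
exists T; split=> //; first by rewrite cT (ltn_predK cV).
move=> e eT; have [y [yT ydiv]] := joinT _ (WT (src e)).
have [z [zT zdiv]] := joinT _ (WT (tgt e)).
(* Along [e], back through the tree to the root, and on to [src e]: a circulation, whose odd part is
   the fundamental circuit. *)
pose x f := (if f == e then 1 else 0) + (y f - z f) : int.
exists [set f | odd (absz (x f))]; split.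
  apply/even_setP => v; rewrite odd_divergence /x divergenceD divergence_delta.
  rewrite divergenceD divergenceN ydiv zdiv mul1r.
  by rewrite opprB [X in _ + X]addrC subrKA -opprB addNr.
by move=> f fT; rewrite inE /x yT ?zT // subrr addr0; case: eqP.
Qed.

End Connectivity.

Lemma bijective_isomorphic (U V : zmodType) (f : U -> V) :
  zmod_morphism f -> injective f -> (forall y, exists x, f x = y) ->
  zmod_isomorphic U V.
Proof.
move=> fB finj /choice[g fK].
pose fM := GRing.isZmodMorphism.Build U V f fB.
pose F : {additive U -> V} := HB.pack f fM.
exists F; exists g => [x|y]; last exact: fK.
by apply: finj; rewrite fK.
Qed.

(** * Coordinates on the hull: [tau] lists the tree edges, [sigma] the others *)

Section Coordinates.
Variables (A : zmodType) (G : mgraph) (p q : nat).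
Variables (tau : 'I_p -> edge G) (sigma : 'I_q -> edge G).
Variable circuit : 'I_q -> {set edge G}.
Hypothesis G3 : three_edge_connected G.
Hypothesis tau_inj : injective tau.
Hypothesis tau_or_sigma : forall f, (exists i, f = tau i) \/ (exists j, f = sigma j).
Hypothesis tau_neq_sigma : forall i j, (tau i == sigma j) = false.
Hypothesis tau_acyclic : forall F : {set edge G},
  (forall j, sigma j \notin F) -> even_set F -> F = set0.
Hypothesis circuit_even : forall j, even_set (circuit j).
Hypothesis circuit_sigma : forall j k, (sigma k \in circuit j) = (k == j).
Notation hull := (@in_cycle_hull A G).

(** What remains on [tau i] once each fundamental circuit is subtracted with coefficient
    [x (sigma j)]. *)
Definition tree_residue (i : 'I_p) (x : {ffun edge G -> A}) : A :=
  x (tau i) - \sum_j (if tau i \in circuit j then x (sigma j) else 0).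

Lemma tree_residue_is_zmod_morphism i : zmod_morphism (tree_residue i).
Proof.
move=> x y; rewrite /tree_residue !ffunE.
have -> : \sum_j (if tau i \in circuit j then (x - y) (sigma j) else 0) =
    \sum_j (if tau i \in circuit j then x (sigma j) else 0) -
    \sum_j (if tau i \in circuit j then y (sigma j) else 0).
  by rewrite -sumrB; apply: eq_bigr => j _; rewrite !ffunE; case: ifP; rewrite ?subr0.
by rewrite opprD addrACA -opprD.
Qed.

HB.instance Definition _ i := GRing.isZmodMorphism.Build {ffun edge G -> A} A
  (tree_residue i) (tree_residue_is_zmod_morphism i).

(* Modulo 2, an even set is the sum of the fundamental circuits of its [sigma] edges. *)
Lemma even_set_parity (C : {set edge G}) f : even_set C ->
  odd (\sum_j (sigma j \in C) * (f \in circuit j))%N = (f \in C).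
Proof.
move=> /even_setP evC.
(* The odd part of [c] is an even set that misses every [sigma k], hence is empty. *)
pose c f := ((f \in C) + \sum_j (sigma j \in C) * (f \in circuit j))%N.
suff c0 : [set h | odd (c h)] = set0.
  have : f \notin [set h | odd (c h)] by rewrite c0 inE.
  by rewrite inE /c oddD oddb; case: (f \in C); case: (odd _).
apply: tau_acyclic => [k|].
  rewrite inE /c (bigD1 k) //= circuit_sigma eqxx muln1 big1 => [|j /negPf jk].
    by rewrite addn0 addnn odd_double.
  by rewrite circuit_sigma eq_sym jk muln0.
apply/even_setP => v; rewrite odd_degree.
have -> : (\sum_h c h * incidence h v =
    degree C v + \sum_j (sigma j \in C) * degree (circuit j) v)%N.
  under eq_bigr do rewrite mulnDl big_distrl /=.
  rewrite big_split /= exchange_big /= degreeE [in RHS]big_mkcond /=; congr (_ + _)%N.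
    by apply: eq_bigr => h _; case: (h \in C); rewrite ?mul0n ?mul1n.
  apply: eq_bigr => j _; rewrite degreeE [in RHS]big_mkcond /= big_distrr /=.
  by apply: eq_bigr => h _; rewrite -mulnA; case: (h \in circuit j); rewrite ?mul0n ?mul1n.
rewrite oddD (negPf (evC v)) (big_morph odd oddD (erefl _)) big1 // => j _.
by have /even_setP/(_ v)/negPf h := circuit_even j; rewrite oddM h andbF.
Qed.

Lemma tree_residue_doubles i x : x \in hull -> tree_residue i x \in @in_doubles A.
Proof.
move=> /asboolP[a ->]; rewrite raddf_sum; apply: rpred_sum => C Ccyc.
apply/asboolP; have := even_set_parity (tau i) (cycle_even Ccyc).
rewrite /= /tree_residue /scaled_chi ffunE.
(* The residue is [a C] times [odd N - N], which equals [-2 * N./2]. *)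
set N := (\sum_j _)%N => oddN; exists (- (a C *+ N./2)).
have -> : \sum_j (if tau i \in circuit j then
    [ffun e => if e \in C then a C else 0] (sigma j) else 0) = a C *+ N.
  rewrite -sumrMnr; apply: eq_bigr => j _; rewrite ffunE mulnC.
  by case: (tau i \in _); case: (sigma j \in C).
have -> : (if tau i \in C then a C else 0) = a C *+ odd N.
  by rewrite oddN; case: (_ \in C).
rewrite -{2}(odd_double_half N) mulrnDr opprD addrA subrr add0r.
by rewrite -muln2 mulrnA mulNrn.
Qed.

Definition coordinates (x : cycle_hull A G) :
    ({ffun 'I_p -> doubles A} * {ffun 'I_q -> A})%type :=
  ([ffun i => Doubles (tree_residue_doubles i (valP x))],
   [ffun j => val x (sigma j)]).

Lemma coordinates_is_zmod_morphism : zmod_morphism coordinates.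
Proof.
move=> x y; congr (_, _); apply/ffunP => i; rewrite !ffunE //.
by apply: val_inj; rewrite /= raddfB raddfB.
Qed.

(** The [sigma] entries are coordinates themselves, and with the residues they determine the [tau]
    entries. *)
Lemma coordinates_inj : injective coordinates.
Proof.
move=> x y [/ffunP eqtau /ffunP eqsigma].
have eqs j : val x (sigma j) = val y (sigma j) by have := eqsigma j; rewrite !ffunE.
apply/val_inj/ffunP => f; case: (tau_or_sigma f) => [[i ->]|[j ->]]; last exact: eqs.
have := congr1 val (eqtau i); rewrite !ffunE /= /tree_residue.
by under eq_bigr do rewrite eqs; move/addIr.
Qed.

Lemma coordinates_surj z : exists x, coordinates x = z.
Proof.
case: z => d b.
(* The circuits realise [b] on the [sigma] edges; the residue cancels their share on the tree and
   leaves [d]. *)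
pose x := \sum_i scaled_chi (val (d i)) [set tau i] +
          \sum_j scaled_chi (b j) (circuit j) : {ffun edge G -> A}.
have xh : x \in hull.
  apply: rpredD; apply: rpred_sum => i _; last exact: hull_even.
  by have /asboolP[a ->] := valP (d i); exact: hull_double.
have xsigma j : x (sigma j) = b j.
  rewrite ffunE !sum_ffunE big1 => [|i _]; last first.
    by rewrite ffunE inE eq_sym tau_neq_sigma.
  rewrite add0r (bigD1 j) //= ffunE circuit_sigma eqxx big1 ?addr0 // => k /negPf kj.
  by rewrite ffunE circuit_sigma eq_sym kj.
exists (CycleHull xh); congr (_, _); apply/ffunP => i; rewrite ffunE //=.
apply: val_inj => /=; rewrite /tree_residue.
under eq_bigr do rewrite xsigma.
rewrite ffunE !sum_ffunE (bigD1 i) //= ffunE set11 big1 => [|k /negPf ki]; last first.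
  by rewrite ffunE inE (inj_eq tau_inj) eq_sym ki.
rewrite addr0; under [X in _ + X - _]eq_bigr do rewrite ffunE.
by rewrite addrK.
Qed.

Lemma cycle_hull_isomorphic : zmod_isomorphic (cycle_hull A G)
  ({ffun 'I_p -> doubles A} * {ffun 'I_q -> A})%type.
Proof.
exact: bijective_isomorphic coordinates_is_zmod_morphism coordinates_inj coordinates_surj.
Qed.

End Coordinates.

Theorem theorem1p6 (G : mgraph) (n m : nat) (A : zmodType)
    (hG : three_edge_connected G) (hn : #|vertex G| = n) (hm : #|edge G| = m) :
  zmod_isomorphic (cycle_hull A G)
    ({ffun 'I_(n - 1) -> doubles A} * {ffun 'I_(m + 1 - n) -> A})%type.
Proof.
have [T [cT acT circT]] := spanning_tree hG.1.
(* The guard makes [circuit] total; its values on tree edges are arbitrary. *)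
have /choice[circuit circuitP] : forall e, exists D, e \notin T ->
    even_set D /\ forall f, f \notin T -> (f \in D) = (f == e).
  by move=> e; case: (boolP (e \in T)) => [|/circT[D ?]]; [exists set0|exists D].
(* Neither natural subtraction truncates, because [#|T|.+1 = n] and [T] has at most [m] edges. *)
have cTn : #|T| = (n - 1)%N by rewrite -hn -cT subn1.
have cTm : #|~: T| = (m + 1 - n)%N by rewrite cardsCs setCK -hm -hn -cT addn1 subSS.
rewrite -cTn -cTm.
have tauT (i : 'I_#|T|) : enum_val i \in T := enum_valP i.
have sigmaT (j : 'I_#|~: T|) : enum_val j \notin T by have := enum_valP j; rewrite inE.
apply: (@cycle_hull_isomorphic A G _ _ enum_val enum_val (circuit \o enum_val)) => //.
- exact: enum_val_inj.
- move=> f; case: (boolP (f \in T)) => fT.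
    by left; exists (enum_rank_in fT f); rewrite enum_rankK_in.
  have fC : f \in ~: T by rewrite inE.
  by right; exists (enum_rank_in fC f); rewrite enum_rankK_in.
- by move=> i j; apply: contraNF (sigmaT j) => /eqP <-.
- move=> F Fsigma; apply: acT; apply/subsetP => f fF; apply/negPn/negP => fT.
  have fC : f \in ~: T by rewrite inE.
  by have := Fsigma (enum_rank_in fC f); rewrite enum_rankK_in ?fF.
- by move=> j; have [] := circuitP _ (sigmaT j).
- move=> j k; have [_ ->] := circuitP _ (sigmaT j); last exact: sigmaT.
  by rewrite (inj_eq enum_val_inj).
Qed.
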